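(* Let $p,\varepsilon\in(0,1)$, set $\mu:=\frac{\varepsilon(1-p)-p}{(1+\varepsilon)(1-p)}$ and $q:=(1+\varepsilon^{-1})p$, and suppose that $\mu>0$. Let $\mathcal{H}$ be a collection of subgraphs of $K_n$ (on vertex set $[n]$), each with $m$ edges, and let $G_0$ be a graph on vertex set $[n]$. Let $G_0'$ be the random subgraph of $G_0$ obtained by keeping each edge of $G_0$ independently with probability $\mu$, and let $\mathbf{G}(n,p)$ be independent of it. Then \[ \mathbb{P}\big[G_0'\cup \mathbf{G}(n,p) \text{ contains some } H\in\mathcal{H}\big]\le \mathbb{P}\left[\begin{array}{c}\text{a uniformly edge-coloured } G_0\cup \mathbf{G}(n,q) \text{ with colours in } [(1+\varepsilon)m]\\ \text{contains a rainbow } H\in\mathcal{H}\end{array}\right]. \]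
   Context: $\mathbf{G}(n,p)$ denotes the binomial random graph on vertex set $[n]$ in which each pair is an edge independently with probability $p$. ''Contains $H$'' means $H$ (a specific subgraph of $K_n$ on $[n]$) is a subgraph. A graph is uniformly edge-coloured in a colour set $\mathcal{C}$ if each edge independently receives a colour chosen uniformly at random from $\mathcal{C}$. A subgraph is rainbow if all its edges have distinct colours. For a real $x$, $[x]$ denotes the colour palette $\{1,\dots,x\}$. *)

(* Defs.v *)
From mathcomp Require Import all_boot all_order all_algebra reals.

Set Implicit Arguments.
Unset Strict Implicit.
Unset Printing Implicit Defensive.

Import Order.TTheory GRing.Theory Num.Theory.
Local Open Scope ring_scope.

(* Since every random graph below has vertex set [n], a graph is identified   *)
(* with its edge set; H is contained in G iff H \subset G.                    *)
Definition edge (n : nat) := {e : {set 'I_n} | #|e| == 2%N}.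
Definition graph (n : nat) := {set edge n}.
Definition complete_graph (n : nat) : graph n := [set: edge n].

Section FiniteProbability.
Variable R : realType.

(* Laws on a finite type are given by their mass functions.                   *)
Definition Pr (T : finType) (w : T -> R) (E : pred T) : R := \sum_(x | E x) w x.

(* The law of (X, Y) where X has law w and, given X = x, Y has law k x.       *)
Definition joint (T U : finType) (w : T -> R) (k : T -> U -> R) (z : T * U) : R :=
  w z.1 * k z.1 z.2.

Definition indep (T U : finType) (w : T -> R) (v : U -> R) : T * U -> R :=
  joint w (fun=> v).

Lemma Pr_joint (T U : finType) (w : T -> R) (k : T -> U -> R) :
    Pr w predT = 1 -> (forall x, Pr (k x) predT = 1) ->
  Pr (joint w k) predT = 1.
Proof.
move=> w1 k1; rewrite /Pr -(pair_big predT predT (fun x y => w x * k x y)) /=.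
by rewrite -[RHS]w1; apply: eq_bigr => x _; rewrite -mulr_sumr [X in _ * X](k1 x) mulr1.
Qed.

End FiniteProbability.

Section RandomGraphs.
Variables (R : realType) (n : nat).

(* The random subgraph of G keeping each edge of G independently with         *)
(* probability p.                                                             *)
Definition percolation (p : R) (G : graph n) (A : graph n) : R :=
  (A \subset G)%:R * \prod_(e in G) (if e \in A then p else 1 - p).

Definition Gnp (p : R) : graph n -> R := percolation p (complete_graph n).

(* A colouring of the edges of G is a function chi on all pairs which is      *)
(* [Some c] on the edges of G and [None] elsewhere. Below is the law in which *)
(* every edge of G independently receives a uniform colour from C.            *)
Definition uniform_colouring (C : finType) (G : graph n)
    (chi : {ffun edge n -> option C}) : R :=
  \prod_e (if chi e is Some _ then (e \in G)%:R / #|C|%:R else (e \notin G)%:R).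

Lemma percolation_ge0 (p : R) (G A : graph n) :
  0 <= p <= 1 -> 0 <= percolation p G A.
Proof.
case/andP=> p0 p1; rewrite mulr_ge0 ?ler0n ?prodr_ge0 // => e _.
by case: ifP; rewrite ?subr_ge0.
Qed.

Lemma Pr_percolation (p : R) (G : graph n) : Pr (percolation p G) predT = 1.
Proof.
pose F e := if e \in G then p else 0; pose F' e := if e \in G then 1 - p else 1.
have -> : 1 = \prod_e (F e + F' e) :> R.
  by rewrite big1 // => e _; rewrite /F /F'; case: ifP; rewrite ?subrKC ?add0r.
rewrite bigA_distr /Pr; apply: eq_big => // A _; rewrite /percolation.
have [sAG|/subsetPn[e eA eG]] := boolP (A \subset G); last first.
  by rewrite mul0r (bigD1 e) //= eA /F (negbTE eG) mul0r.
rewrite mul1r big_mkcond; apply: eq_bigr => e _; rewrite /F /F'.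
case: (boolP (e \in G)) => // eG.
by rewrite (negbTE (contra (subsetP sAG e) eG)).
Qed.

Lemma uniform_colouring_ge0 (C : finType) (G : graph n) chi :
  0 <= @uniform_colouring C G chi.
Proof.
by apply: prodr_ge0 => e _; case: (chi e) => *; rewrite ?divr_ge0 ?ler0n.
Qed.

Lemma Pr_uniform_colouring (C : finType) (G : graph n) :
  (0 < #|C|)%N -> Pr (@uniform_colouring C G) predT = 1.
Proof.
move=> C0; rewrite /Pr /uniform_colouring.
rewrite -(bigA_distr_bigA (fun e (o : option C) =>
  if o is Some _ then (e \in G)%:R / #|C|%:R else (e \notin G)%:R)) /=.
rewrite big1 // => e _; rewrite (bigD1 None) //=.
rewrite (reindex_omap Some id) /=; last by case.
rewrite (eq_bigl predT) => [|c]; last by rewrite /= eqxx.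
rewrite sumr_const; case: (e \in G) => /=; last by rewrite mul0r mul0rn addr0.
by rewrite add0r mul1r -[LHS]mulr_natr mulVf // pnatr_eq0 -lt0n.
Qed.

End RandomGraphs.

Arguments Gnp {R} n p.
Arguments uniform_colouring {R n} C G chi.

Definition contains_some (n : nat) (HH : {set graph n}) (G : graph n) : bool :=
  [exists H in HH, H \subset G].

Definition rainbow (n : nat) (C : finType) (chi : {ffun edge n -> option C})
    (H : graph n) : bool :=
  dinjectiveb chi H.

Definition contains_rainbow (n : nat) (C : finType) (HH : {set graph n})
    (G : graph n) (chi : {ffun edge n -> option C}) : bool :=
  [exists H in HH, (H \subset G) && rainbow chi H].

(* The palette [x] = {1, ..., x}: the positive integers at most x, of which   *)
(* there are floor(x), indexed from 0.                                        *)
Definition palette (R : realType) (x : R) : finType := 'I_(Num.truncn x).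

(* Main.v *)
Require Import Defs.
From mathcomp Require Import all_boot all_order all_algebra reals.
From mathcomp Require Import ring lra.

Set Implicit Arguments.
Unset Strict Implicit.
Unset Printing Implicit Defensive.

Import Order.TTheory GRing.Theory Num.Theory.
Local Open Scope ring_scope.

(** With [s = eps / (1 + eps)], an edge lies in [G0' :|: G(n,p)] with
    probability [s] if it belongs to [G0] and [p = q * s] otherwise, that is,
    [s] times the probability that it lies in [G0 :|: G(n,q)].  The two sides
    are interpolated one edge at a time: for a set [D] of edges, an edge [e] is
    present with probability [r e] if [e \in D] and [r e * s] otherwise, and
    only the colours of the edges in [D] are required to be distinct.  Moving
    an edge [f] into [D] cannot lower the probability of success: given the
    other edges, if success hinges on [f] being present in some [H], then at
    most [m - 1] of the [k] colours are forbidden for [f], so the conditional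
    probability goes from [r f * s] to at least [r f * (k - (m - 1)) / k]. *)

(** * Product laws and comparison in a single coordinate *)

Section ProductLaw.
Variables (R : realType) (I S : finType).
Implicit Types (w : I -> S -> R) (x : {ffun I -> S}).

Definition prod_law w x : R := \prod_i w i (x i).

Definition update x i s : {ffun I -> S} := [ffun j => if j == i then s else x j].

Lemma updateK x i s : update (update x i s) i (x i) = x.
Proof. by apply/ffunP => j; rewrite !ffunE; case: eqP => // ->. Qed.

(* Both sides are the sum over pairs (x, s), and the involution swapping [x i]
   with [s] exchanges the roles of [v] and [w i]. *)
Lemma prod_law_resample w (v : S -> R) i (F : {ffun I -> S} -> R) :
  \sum_s v s = 1 ->
  \sum_x prod_law w x * F x =
  \sum_(x : {ffun I -> S}) (\prod_(j | j != i) w j (x j)) * v (x i) *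
         \sum_s w i s * F (update x i s).
Proof.
move=> v1; pose P (x : {ffun I -> S}) := \prod_(j | j != i) w j (x j).
have PU x s : P (update x i s) = P x.
  by apply: eq_bigr => j /negbTE ji; rewrite ffunE ji.
transitivity (\sum_(z : {ffun I -> S} * S)
    P z.1 * v z.2 * (w i (z.1 i) * F z.1)).
  rewrite -(pair_big predT predT
    (fun (x : {ffun I -> S}) s => P x * v s * (w i (x i) * F x))) /=.
  apply: eq_bigr => x _; rewrite -mulr_suml -mulr_sumr v1 mulr1 /prod_law.
  by rewrite (bigD1 i) //= mulrA [P x * _]mulrC.
pose g (z : {ffun I -> S} * S) := (update z.1 i z.2, z.1 i).
have gK : involutive g.
  by case=> x s; rewrite /g /= updateK ffunE eqxx.
rewrite (reindex_inj (inv_inj gK)) /=.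
rewrite -(pair_big predT predT (fun (x : {ffun I -> S}) s => P (update x i s) * v (x i) *
  (w i (update x i s i) * F (update x i s)))) /=.
apply: eq_bigr => x _; rewrite mulr_sumr; apply: eq_bigr => s _.
by rewrite PU ffunE eqxx.
Qed.

(** Off [i] the two laws agree. Resampling both sides with the same auxiliary law [w i] gives them
    equal nonnegative outer weights, which leaves only the inner sums over the state at [i]. *)
Lemma le_prod_law_coord w w' i (F F' : {ffun I -> S} -> R) :
  (forall j s, 0 <= w j s) -> \sum_s w i s = 1 ->
  (forall j, j != i -> w' j =1 w j) ->
  (forall x, \sum_s w i s * F (update x i s) <=
             \sum_s w' i s * F' (update x i s)) ->
  \sum_x prod_law w x * F x <= \sum_x prod_law w' x * F' x.
Proof.
move=> w0 wi1 ww' le_i; rewrite !(@prod_law_resample _ (w i) i) //.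
apply: ler_sum => x _.
rewrite [X in _ <= X * _ * _](eq_bigr (fun j => w j (x j))) => [|j ji]; last first.
  by rewrite ww'.
by apply: ler_wpM2l => //; rewrite mulr_ge0 ?prodr_ge0.
Qed.

End ProductLaw.

(** * Random coloured sets and the change of one element *)

Section Interpolation.
Variables (R : realType) (I C : finType).
Implicit Types (D H : {set I}) (chi : {ffun I -> option C}) (t : R).

(** Presence and colour are merged into one state, so that a random coloured graph is a single
    product law. *)
Definition coloured_law t (o : option C) : R :=
  if o is Some _ then t / #|C|%:R else 1 - t.

Definition support chi : {set I} := [set i | chi i].

(** The case [D = set0] is plain containment, and [D = setT] asks for a rainbow copy. *)
Definition rainbow_on D chi H : bool :=
  (H \subset support chi) && dinjectiveb chi (H :&: D).

Definition some_rainbow_on D (HH : {set {set I}}) chi : bool :=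
  [exists H in HH, rainbow_on D chi H].

Hypothesis C_gt0 : (0 < #|C|)%N.

Lemma sum_option (F : option C -> R) :
  \sum_o F o = F None + \sum_c F (Some c).
Proof.
rewrite (bigD1 None) //=; congr (_ + _).
rewrite (reindex_omap Some id) /=; last by case.
by apply: eq_bigl => c /=; rewrite eqxx.
Qed.

Lemma sum_coloured_law_Some t : \sum_c coloured_law t (Some c) = t.
Proof.
rewrite /= sumr_const -[LHS]mulr_natr divfK // pnatr_eq0 -lt0n //.
Qed.

Lemma sum_coloured_law t : \sum_o coloured_law t o = 1.
Proof. by rewrite sum_option sum_coloured_law_Some subrK. Qed.

Lemma coloured_law_ge0 t o : 0 <= t <= 1 -> 0 <= coloured_law t o.
Proof.
by case/andP=> t0 t1; case: o => [c|]; rewrite /= ?subr_ge0 // divr_ge0.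
Qed.

(** The state of [f] is invisible to [H], and [H] meets [f |: D] only inside [D]. *)
Lemma rainbow_on_update D chi H f o o' :
  f \notin H -> rainbow_on D (update chi f o) H ->
  rainbow_on (f |: D) (update chi f o') H.
Proof.
move=> fH /andP[/subsetP sH /dinjectiveP injH].
have upd i : i \in H -> update chi f o' i = update chi f o i.
  by move=> iH; rewrite !ffunE; case: eqP => // ei; rewrite -ei iH in fH.
have HD i : i \in H :&: (f |: D) -> i \in H :&: D.
  rewrite !inE => /andP[iH]; rewrite iH; case/orP=> // /eqP ei.
  by case/negP: fH; rewrite -ei.
apply/andP; split.
  by apply/subsetP => i iH; have := sH i iH; rewrite !inE upd.
apply/dinjectiveP => i j iHD jHD; rewrite !upd; last 2 first.
- by case/setIP: jHD.
- by case/setIP: iHD.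
by apply: injH; apply: HD.
Qed.

(** At most [f] joins the elements whose colours must differ. The colours on [H :&: D] do not
    change, since [f] is outside [D], and [c'] is not among them. *)
Lemma rainbow_on_fresh D chi H f c c' :
  f \notin D -> rainbow_on D (update chi f (Some c)) H ->
  Some c' \notin chi @: (H :&: D) ->
  rainbow_on (f |: D) (update chi f (Some c')) H.
Proof.
move=> fD /andP[/subsetP sH /dinjectiveP injH] fresh.
have neqf i : i \in D -> (i == f) = false.
  by move=> iD; apply/eqP => ei; rewrite -ei iD in fD.
apply/andP; split.
  by apply/subsetP => i /sH; rewrite !inE !ffunE; case: eqP.
have fresh_neq i : i \in H -> i \in D -> chi i <> Some c'.
  by move=> iH iD ei; case/negP: fresh; rewrite -ei imset_f // inE iH.
apply/dinjectiveP => i j; rewrite !inE => /andP[iH iD] /andP[jH jD].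
rewrite !ffunE; move: iD jD.
case: eqP => [->|_] /= iD; case: eqP => [->|_] //= jD.
- by move=> /esym /(fresh_neq _ jH jD).
- by move=> /(fresh_neq _ iH iD).
by move=> eij; apply: injH; rewrite ?inE ?iH ?jH // !ffunE !neqf.
Qed.

Variables (r : I -> R) (s : R) (m : nat) (HH : {set {set I}}).
Hypothesis r01 : forall i, 0 <= r i <= 1.
Hypothesis s01 : 0 <= s <= 1.
Hypothesis HHm : forall H, H \in HH -> #|H| = m.
Hypothesis sC : s * #|C|%:R <= #|C|%:R - m.-1%:R.

Definition interpolation D i : option C -> R :=
  coloured_law (if i \in D then r i else r i * s).

Lemma interpolation_ge0 D i o : 0 <= interpolation D i o.
Proof.
apply: coloured_law_ge0; case: ifP => _ //.
have /andP[r0 r1] := r01 i; have /andP[s0 s1] := s01.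
by rewrite mulr_ge0 // mulr_ile1.
Qed.

Lemma interpolation_step D f : f \notin D ->
  \sum_chi prod_law (interpolation D) chi * (some_rainbow_on D HH chi)%:R <=
  \sum_chi prod_law (interpolation (f |: D)) chi *
           (some_rainbow_on (f |: D) HH chi)%:R.
Proof.
move=> fD; apply: (@le_prod_law_coord _ _ _ _ _ f).
- exact: interpolation_ge0.
- exact: sum_coloured_law.
- by move=> j jf o; rewrite /interpolation !inE (negbTE jf).
move=> chi.
have rhs0 : 0 <= \sum_o interpolation (f |: D) f o *
    (some_rainbow_on (f |: D) HH (update chi f o))%:R.
  by apply: sumr_ge0 => o _; rewrite mulr_ge0 ?interpolation_ge0.
(* If success occurs without [f], it persists in every state of [f], and the right side is the full
   mass 1. *)
have [/existsP[H /andP[HHH Hgood]]|noneN] :=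
  boolP (some_rainbow_on D HH (update chi f None)).
  have fH : f \notin H.
    apply/negP => fH; case/andP: Hgood => /subsetP/(_ f fH).
    by rewrite inE ffunE eqxx.
  rewrite [leRHS](eq_bigr (interpolation (f |: D) f)) => [|o _]; last first.
    suff -> : some_rainbow_on (f |: D) HH (update chi f o) by rewrite mulr1.
    apply/existsP; exists H; rewrite HHH /=.
    exact: rainbow_on_update Hgood.
  rewrite sum_coloured_law -[leRHS](sum_coloured_law (if f \in D then r f else r f * s)).
  apply: ler_sum => o _; rewrite ler_piMr ?interpolation_ge0 //.
  by rewrite lern1 leq_b1.
(* If no state of [f] gives success, the left side is 0. *)
have [/existsP[c /existsP[H /andP[HHH Hgood]]]|noneS] :=
  boolP [exists c, some_rainbow_on D HH (update chi f (Some c))]; last first.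
  rewrite big1 // => -[c|] _; last by rewrite (negbTE noneN) mulr0.
  by move/existsPn: noneS => /(_ c)/negbTE ->; rewrite mulr0.
(* Otherwise [H] would succeed with [f] absent, against [noneN]. *)
have fH : f \in H.
  apply: contraR noneN => fH; apply/existsP; exists H; rewrite HHH /=.
  have := rainbow_on_update None fH Hgood.
  case/andP=> sH /dinjectiveP injH; apply/andP; split=> //.
  apply/dinjectiveP => i j; rewrite !inE => /andP[iH iD] /andP[jH jD].
  by apply: injH; rewrite !inE ?iH ?jH ?iD ?jD orbT.
(* Success on the left forces [f] to be present, which has probability [r f * s] because [f] is not
   yet in [D]. *)
apply: (@le_trans _ _ (r f * s)).
  rewrite sum_option (negbTE noneN) mulr0 add0r.
  rewrite -[leRHS]sum_coloured_law_Some; apply: ler_sum => c' _.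
  rewrite {1}/interpolation (negbTE fD) ler_piMr //; last by rewrite lern1 leq_b1.
  by have := interpolation_ge0 D f (Some c'); rewrite /interpolation (negbTE fD).
pose fresh := [set c' : C | Some c' \notin chi @: (H :&: D)].
(* As [f] lies in [H] but not in [D], the set [H :&: D] has at most [m.-1] elements and forbids at
   most that many colours. *)
have card_fresh : (#|C| <= #|fresh| + m.-1)%N.
  rewrite -(cardsC fresh) leq_add2l -(card_imset _ Some_inj).
  apply: (@leq_trans #|chi @: (H :&: D)|).
    apply/subset_leq_card/subsetP => _ /imsetP[c' c'F ->].
    by move: c'F; rewrite !inE negbK.
  apply: leq_trans (leq_imset_card _ _) _.
  rewrite -(HHm HHH) (cardsD1 f H) fH /=; apply/subset_leq_card/subsetP => i.
  rewrite !inE => /andP[-> iD]; rewrite andbT.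
  by apply: contraNneq fD => <-.
(* By [sC], a uniform colour is fresh with probability at least [s]. *)
apply: (@le_trans _ _ (\sum_(c' in fresh) r f / #|C|%:R)).
  have /andP[r0 _] := r01 f.
  rewrite sumr_const -[leRHS]mulr_natr -mulrA; apply: ler_wpM2l => //.
  rewrite mulrC ler_pdivlMr ?ltr0n //; apply: le_trans sC _.
  by rewrite lerBlDr -natrD ler_nat.
rewrite sum_option; apply: ler_wpDl.
  by rewrite mulr_ge0 ?interpolation_ge0.
rewrite big_mkcond; apply: ler_sum => c' _.
case: ifP => [|_]; last by rewrite mulr_ge0 ?interpolation_ge0.
rewrite inE => c'F; rewrite /interpolation setU11 /=.
suff -> : some_rainbow_on (f |: D) HH (update chi f (Some c')) by rewrite mulr1.
apply/existsP; exists H; rewrite HHH /=.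
exact: rainbow_on_fresh Hgood c'F.
Qed.

Lemma interpolation_le D :
  \sum_chi prod_law (interpolation set0) chi * (some_rainbow_on set0 HH chi)%:R <=
  \sum_chi prod_law (interpolation D) chi * (some_rainbow_on D HH chi)%:R.
Proof.
have [k] := ubnP #|D|; elim: k D => // k IHk D.
have [->//|[f fD]] := set_0Vmem D.
rewrite (cardsD1 f) fD ltnS => /IHk /le_trans; apply.
rewrite -[in leRHS](setD1K fD); apply: interpolation_step.
by rewrite !inE eqxx.
Qed.

End Interpolation.

Arguments coloured_law {R} C t o.

(** * Random graph laws as products over edges *)

Section RandomGraphLaws.
Variables (R : realType) (n : nat).
Implicit Types (G A B U : graph n) (p q : R).

(** The indicator of [A \subset G] is absorbed into the factors, so that sums over [A] can be
    exchanged with the product. *)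
Lemma percolationE p G A :
  percolation p G A = \prod_e (if e \in A then (if e \in G then p else 0)
                               else (if e \in G then 1 - p else 1)).
Proof.
rewrite /percolation; have [sAG|/subsetPn[e eA eG]] := boolP (A \subset G).
  rewrite mul1r big_mkcond; apply: eq_bigr => e _.
  have [eG|eG] := boolP (e \in G) => //.
  by rewrite (negbTE (contra (subsetP sAG e) eG)).
by rewrite mul0r (bigD1 e) //= eA (negbTE eG) mul0r.
Qed.

Lemma GnpE p A : Gnp n p A = \prod_e (if e \in A then p else 1 - p).
Proof.
by rewrite /Gnp percolationE; apply: eq_bigr => e _; rewrite inE.
Qed.

Definition bernoulli_graph (t : edge n -> R) U : R :=
  \prod_e (if e \in U then t e else 1 - t e).

(** Writing the indicator edge by edge lets it merge with product weights. *)
Lemma natr_eq_prod U V : (U == V :> graph n)%:R =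
  \prod_e ((e \in U) == (e \in V))%:R :> R.
Proof.
have [->|] := eqVneq U V; first by rewrite big1 // => e _; rewrite eqxx.
move=> neqUV; apply/esym/eqP; apply: contraNT neqUV.
rewrite prodf_seq_neq0 => /allP UV; apply/eqP/setP => e.
by have := UV e (mem_index_enum e); case: (_ =P (e \in V)) => //= _; rewrite eqxx.
Qed.

(** Passing to the law of [h x] reduces an identity of expectations to one of masses at each [U]. *)
Lemma sum_fibre (T : finType) (w : T -> R) (h : T -> graph n) (F : graph n -> R) :
  \sum_x w x * F (h x) = \sum_U (\sum_x w x * (h x == U)%:R) * F U.
Proof.
under [RHS]eq_bigr do rewrite mulr_suml.
rewrite exchange_big; apply: eq_bigr => x _ /=.
rewrite (bigD1 (h x)) //= eqxx mulr1 big1 ?addr0 // => U.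
by rewrite eq_sym => /negbTE ->; rewrite mulr0 mul0r.
Qed.

(** An edge of [G] is missing from the union exactly when both independent graphs miss it. *)
Lemma union_law p q G (F : graph n -> R) :
  \sum_x indep (percolation p G) (Gnp n q) x * F (x.1 :|: x.2) =
  \sum_U bernoulli_graph
           (fun e => if e \in G then 1 - (1 - p) * (1 - q) else q) U * F U.
Proof.
rewrite (sum_fibre _ (fun x : graph n * graph n => x.1 :|: x.2)).
apply: eq_bigr => U _; congr (_ * _).
pose a b e := if b then (if e \in G then p else 0)
              else (if e \in G then 1 - p else 1) : R.
pose g b := if b then q else 1 - q : R.
(* The contribution of [e] when [b] and [b'] record its membership in the two graphs;
   distributivity, used twice, sums it over all four cases. *)
pose h b b' e := a b e * g b' * ((b || b') == (e \in U))%:R.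
transitivity (\sum_(A : graph n) \sum_(B : graph n) \prod_e h (e \in A) (e \in B) e).
  rewrite pair_big; apply: eq_bigr => -[A B] _ /=.
  rewrite /indep /joint /= percolationE GnpE natr_eq_prod -!big_split /=.
  by apply: eq_bigr => e _; rewrite inE.
transitivity (\sum_(A : graph n) \prod_e (if e \in A then h true true e + h true false e
                              else h false true e + h false false e)).
  apply: eq_bigr => A _.
  transitivity (\prod_e (h (e \in A) true e + h (e \in A) false e)).
    rewrite bigA_distr; apply: eq_bigr => B _; apply: eq_bigr => e _.
    by case: (e \in B).
  by apply: eq_bigr => e _; case: (e \in A).
rewrite -bigA_distr; apply: eq_bigr => e _; rewrite /h /a /g /=.
by case: (e \in G); case: (e \in U); rewrite /= ?mulr0 ?mulr1; ring.
Qed.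

Variable C : finType.
Hypothesis C_gt0 : (0 < #|C|)%N.

Lemma support_law (t : edge n -> R) (F : graph n -> R) :
  \sum_chi prod_law (fun e => coloured_law C (t e)) chi * F (support chi) =
  \sum_U bernoulli_graph t U * F U.
Proof.
rewrite (sum_fibre _ (@support _ C)).
apply: eq_bigr => U _; congr (_ * _).
transitivity (\sum_(chi : {ffun edge n -> option C})
    \prod_e (coloured_law C (t e) (chi e) * (isSome (chi e) == (e \in U))%:R)).
  apply: eq_bigr => chi _; rewrite natr_eq_prod -big_split /=.
  by apply: eq_bigr => e _; rewrite inE.
rewrite -(bigA_distr_bigA (fun e o =>
  coloured_law C (t e) o * (isSome o == (e \in U))%:R)) /=.
apply: eq_bigr => e _; rewrite sum_option -mulr_suml sum_coloured_law_Some //.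
by case: (e \in U); rewrite /= ?mulr0 ?mulr1 ?addr0 ?add0r.
Qed.

(** A colouring of nonzero mass determines its graph, so events on the pair can be read off [chi]
    alone. *)
Lemma uniform_colouring_support G (chi : {ffun edge n -> option C}) :
  uniform_colouring C G chi != 0 :> R -> support chi = G.
Proof.
rewrite /uniform_colouring prodf_seq_neq0 => /allP chi0.
apply/setP => e; have := chi0 e (mem_index_enum e); rewrite inE.
by case: (chi e) => [c|]; case: (e \in G); rewrite /= ?mul0r ?eqxx.
Qed.

Lemma coloured_union_law q G (chi : {ffun edge n -> option C}) :
  \sum_A Gnp n q A * uniform_colouring C (G :|: A) chi =
  prod_law (fun e => coloured_law C (if e \in G then 1 else q)) chi.
Proof.
pose h b e : R := (if b then q else 1 - q) *
  if chi e is Some _ then ((e \in G) || b)%:R / #|C|%:R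
  else (~~ ((e \in G) || b))%:R.
transitivity (\sum_(A : graph n) \prod_e (if e \in A then h true e else h false e)).
  apply: eq_bigr => A _; rewrite GnpE -big_split; apply: eq_bigr => e _ /=.
  by rewrite inE /h; case: (e \in A).
rewrite -bigA_distr; apply: eq_bigr => e _; rewrite /h.
by case: (chi e) => [c|]; case: (e \in G) => /=; ring.
Qed.

End RandomGraphLaws.

(** * Choice of the constants and identification of the two ends of the interpolation *)

Theorem theorem1p1 (R : realType) (n m : nat) (p eps : R)
    (HH : {set graph n}) (G0 : graph n) :
  let mu := (eps * (1 - p) - p) / ((1 + eps) * (1 - p)) in
  let q := (1 + eps^-1) * p in
  let C := palette ((1 + eps) * m%:R) in
  0 < p < 1 -> 0 < eps < 1 -> 0 < mu ->
  (0 < m)%N ->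
  (forall H, H \in HH -> #|H| = m) ->
  Pr (indep (percolation mu G0) (Gnp n p))
     (fun w => contains_some HH (w.1 :|: w.2))
  <=
  Pr (joint (Gnp n q) (fun G => uniform_colouring C (G0 :|: G)))
     (fun w => contains_rainbow HH (G0 :|: w.1) w.2).
Proof.
move=> mu q C /andP[p0 p1] /andP[eps0 eps1] mu0 m0 HHm.
pose s := eps / (1 + eps).
pose r (e : edge n) := if e \in G0 then 1 else q.
have eps10 : 0 < 1 + eps by lra.
have p10 : 0 < 1 - p by lra.
(* This is [0 < mu] cleared of denominators; it amounts to [q < 1]. *)
have peps : (1 + eps) * p < eps.
  move: mu0; rewrite /mu pmulr_lgt0 ?invr_gt0 ?mulr_gt0 //; lra.
have q0 : 0 <= q by rewrite mulr_ge0 ?addr_ge0 ?invr_ge0 // ltW.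
have qE : q = (1 + eps) * p / eps by rewrite /q; field; rewrite gt_eqF.
have q1 : q <= 1 by rewrite qE ler_pdivrMr // mul1r ltW.
have s01 : 0 <= s <= 1 by rewrite divr_ge0 ?ler_pdivrMr //=; lra.
have m1 : 1 <= m%:R :> R by rewrite ler1n.
have x0 : 0 <= (1 + eps) * m%:R by rewrite mulr_ge0 // ltW.
have /andP[kx xk] := truncn_itv x0.
have CE : #|C| = Num.truncn ((1 + eps) * m%:R) by rewrite card_ord.
have C_gt0 : (0 < #|C|)%N by rewrite CE truncn_gt0; nra.
(* Equivalent to [(1 + eps) * (m - 1) <= #|C|]: rounding [(1 + eps) * m] down loses less than 1,
   while passing from [m] to [m - 1] frees [1 + eps]. *)
have sC : s * #|C|%:R <= #|C|%:R - m.-1%:R.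
  rewrite CE; set k := Num.truncn _ in xk *.
  have mE : m%:R = m.-1%:R + 1 :> R by rewrite natr1 prednK.
  rewrite -natr1 mE in xk.
  rewrite /s mulrAC ler_pdivrMr //; nra.
have r01 e : 0 <= r e <= 1 by rewrite /r; case: ifP; rewrite ?q0 ?q1 ?ler01 ?lexx.
have := @interpolation_le R _ _ C_gt0 r s m HH r01 s01 HHm sC [set: edge n].
set L := leLHS; set L' := leRHS => LL'.
rewrite (_ : Pr _ _ = L); last first.
  rewrite /Pr big_mkcond /=.
  transitivity (\sum_x indep (percolation mu G0) (Gnp n p) x *
                 (contains_some HH (x.1 :|: x.2))%:R).
    by apply: eq_bigr => x _; case: ifP; rewrite ?mulr1 ?mulr0.
  rewrite (union_law _ _ _ (fun U => (contains_some HH U)%:R)).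
  rewrite -(support_law C_gt0); apply: eq_bigr => chi _; congr (_ * _).
    apply: eq_bigr => e _; rewrite /interpolation inE /r; congr coloured_law.
    (* On [G0], [1 - mu = 1 / ((1 + eps) * (1 - p))], so an edge is missed with probability
       [1 / (1 + eps) = 1 - s]. Off [G0], [p = q * s]. *)
    case: ifP => _.
      by rewrite /mu /s; field; rewrite !gt_eqF.
    by rewrite qE /s; field; rewrite !gt_eqF.
  congr (nat_of_bool _)%:R; apply: eq_existsb => H; congr (_ && _).
  rewrite /rainbow_on; case: (H \subset _) => //=; apply/esym/dinjectiveP.
  by move=> i j; rewrite setI0 inE.
rewrite (_ : Pr _ _ = L') // /Pr big_mkcond /=.
transitivity (\sum_x joint (Gnp n q) (fun G => uniform_colouring C (G0 :|: G)) x *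
               (some_rainbow_on setT HH x.2)%:R).
  apply: eq_bigr => -[A chi] _ /=; rewrite /joint /=.
  (* Pairs of mass 0 contribute nothing; on the others [support chi = G0 :|: A] and the two events
     coincide. *)
  have [->|/uniform_colouring_support suppE] :=
    eqVneq (uniform_colouring C (G0 :|: A) chi : R) 0.
    by rewrite mulr0 mul0r if_same.
  suff -> : contains_rainbow HH (G0 :|: A) chi = some_rainbow_on setT HH chi.
    by case: ifP; rewrite ?mulr1 ?mulr0.
  apply: eq_existsb => H.
  by rewrite /rainbow_on suppE setIT.
rewrite -(pair_big predT predT (fun A chi =>
  joint (Gnp n q) (fun G => uniform_colouring C (G0 :|: G)) (A, chi) *
  (some_rainbow_on setT HH chi)%:R)) /= exchange_big.
apply: eq_bigr => chi _ /=; rewrite -mulr_suml; congr (_ * _).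
rewrite coloured_union_law; apply: eq_bigr => e _.
by rewrite /interpolation inE.
Qed.
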